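(* Let $R$ be a ring and let $\Delta: R\hookrightarrow R\times R$ be the diagonal map, given by $\Delta(r)=(r,r)$ for all $r\in R$. Then for any $a,b\in R$, $\Delta(R)[(a,b)]\subset R\times R$ is a minimal ring extension if and only if the ideal $\langle a-b\rangle$ is a maximal ideal of $R$.
   Context: All rings are commutative with nonzero identity, and all ring extensions (subrings) and ring homomorphisms are unital. For a proper subring $A$ of a ring $B$, the extension $A\subset B$ is called a minimal ring extension (equivalently, $A$ is a maximal subring of $B$) if there is no ring $S$ with $A\subset S\subset B$, where $\subset$ denotes proper inclusion. $\Delta(R)[(a,b)]$ denotes the subring of $R\times R$ generated by $\Delta(R)$ and the element $(a,b)$, and $\langle a-b\rangle$ denotes the principal ideal of $R$ generated by $a-b$. *)

(* Defs.v *)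
From HB Require Import structures.
From mathcomp Require Import all_boot all_order all_algebra.
From mathcomp Require Import all_classical.

Set Implicit Arguments.
Unset Strict Implicit.
Unset Printing Implicit Defensive.

Import GRing.Theory.

Local Open Scope classical_set_scope.
Local Open Scope ring_scope.

(* Subrings and ideals are classical sets (Prop-valued), so that no decidability
   of membership is required. *)

Definition subring (B : comNzRingType) (S : set B) : Prop :=
  GRing.subring_closed [in S].

(* A and B are given inside a common ambient ring T; any ring lying between A
   and B with the same operations is a subring of T. *)
Definition minimal_ring_extension (T : comNzRingType) (A B : set T) : Prop :=
  [/\ subring A, subring B, A `<` B &
      ~ exists S : set T, [/\ subring S, A `<` S & S `<` B]].

(* A[x] *)
Definition adjoin (B : comNzRingType) (A : set B) (x : B) : set B :=
  smallest (@subring B) (A `|` [set x]).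

Definition diag (R : comNzRingType) (r : R) : R * R := (r, r).

Definition principal_ideal (R : comNzRingType) (x : R) : set R :=
  [set r * x | r in [set: R]].

(* idealr_closed already requires 1 \notin I, i.e. that the ideal is proper. *)
Definition maximal_ideal (R : comNzRingType) (M : set R) : Prop :=
  idealr_closed [in M] /\
  forall I : set R, idealr_closed [in I] -> M `<=` I -> I = M.

(* Main.v *)
Require Import Defs.
From mathcomp Require Import all_boot all_order all_algebra.
From mathcomp Require Import all_classical.
From mathcomp Require Import ring.

Import GRing.Theory.

Local Open Scope classical_set_scope.
Local Open Scope ring_scope.

(** The subrings of [R * R] containing the diagonal form a lattice isomorphic
    to the lattice of all ideals of [R], the unit ideal included.  An ideal [I]
    corresponds to the ring [fiber_square I] of pairs congruent modulo [I],
    that is, the fibre product of [R] with itself over [R / I]; a subring [S]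
    corresponds to its trace [first_axis S] on the first factor.  The two maps
    are inverse to each other because [(x, y)] differs from [(x - y, 0)] by the
    diagonal element [(y, y)] ([fiber_squareK], [first_axisK]).

    Under this isomorphism the whole ring [R * R] corresponds to the unit ideal,
    and the subring generated by the diagonal and [(a, b)] to the ideal generated
    by [a - b] ([adjoin_diagE]).  There is thus no ring strictly between
    [adjoin (range diag) (a, b)] and [R * R] exactly when there is no ideal
    strictly between [principal_ideal (a - b)] and [R], and that ring is proper
    exactly when that ideal is. *)

(** Unlike [idealr_closed], this admits the unit ideal, which is needed to match
    the subring [R * R]. *)
Definition ideal_or_unit {R : comNzRingType} (I : set R) : Prop :=
  I 0 /\ forall r x y, I x -> I y -> I (r * x + y).

Definition fiber_square {R : comNzRingType} (I : set R) : set (R * R) :=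
  [set p | I (p.1 - p.2)].

Definition first_axis {R : comNzRingType} (S : set (R * R)) : set R :=
  [set x | S (x, 0)].

Lemma idealr_closedP {R : comNzRingType} (I : set R) :
  idealr_closed [in I] <-> ideal_or_unit I /\ ~ I 1.
Proof.
split=> [[I0 I1 IZD]|[[I0 IZD] I1]].
  split; last by move=> /mem_set I1'; move/negP: I1; apply.
  split=> [|r x y Ix Iy]; first exact: set_mem I0.
  by apply: set_mem; apply: IZD; exact: mem_set.
split; [exact: mem_set | by apply/negP => /set_mem |].
by move=> r x y /set_mem Ix /set_mem Iy; apply: mem_set; exact: IZD.
Qed.

Lemma subringP {B : comNzRingType} (S : set B) :
  subring S <-> [/\ S 1, forall x y, S x -> S y -> S (x - y)
                       & forall x y, S x -> S y -> S (x * y)].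
Proof.
split=> [[S1 SB SM]|[S1 SB SM]]; split.
- exact: set_mem S1.
- by move=> x y Sx Sy; apply: set_mem; apply: SB; exact: mem_set.
- by move=> x y Sx Sy; apply: set_mem; apply: SM; exact: mem_set.
- exact: mem_set.
- by move=> x y /set_mem Sx /set_mem Sy; apply: mem_set; exact: SB.
- by move=> x y /set_mem Sx /set_mem Sy; apply: mem_set; exact: SM.
Qed.

Lemma subring_add {B : comNzRingType} {S : set B} {x y : B} :
  subring S -> S x -> S y -> S (x + y).
Proof.
move=> /subringP[S1 SB _] Sx Sy; rewrite -[y]opprK -[- y]add0r.
by apply: (SB) => //; apply: (SB) => //; rewrite -(subrr 1); exact: SB.
Qed.

Lemma principal_ideal_or_unit {R : comNzRingType} (x : R) :
  ideal_or_unit (principal_ideal x).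
Proof.
split; first by exists 0; rewrite ?mul0r.
by move=> r _ _ [s _ <-] [t _ <-]; exists (r * s + t) => //; ring.
Qed.

Lemma ideal_or_unit_eqT {R : comNzRingType} {I : set R} :
  ideal_or_unit I -> I 1 -> I = [set: R].
Proof.
move=> [I0 IZD] I1; apply/seteqP; split=> // x _.
by rewrite -[x]mulr1 -[x * 1]addr0; exact: IZD.
Qed.

(** Closure under products uses the identity
    [x * z - y * t = z * (x - y) + y * (z - t)]. *)
Lemma fiber_square_subring {R : comNzRingType} {I : set R} :
  ideal_or_unit I -> subring (fiber_square I).
Proof.
move=> [I0 IZD]; apply/subringP; split.
- by rewrite /fiber_square /= subrr.
- move=> [x y] [z t]; rewrite /fiber_square /= => Ixy Izt.
  have -> : x - z - (y - t) = -1 * (z - t) + (x - y) by ring.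
  exact: IZD.
- move=> [x y] [z t]; rewrite /fiber_square /= => Ixy Izt.
  have -> : x * z - y * t = z * (x - y) + (y * (z - t) + 0) by ring.
  by apply: (IZD) => //; exact: IZD.
Qed.

Lemma diag_fiber_square {R : comNzRingType} {I : set R} :
  ideal_or_unit I -> range (@diag R) `<=` fiber_square I.
Proof. by move=> [I0 _] _ [r _ <-]; rewrite /fiber_square /= subrr. Qed.

(** Multiplication by the diagonal element [(r, r)] is what makes the trace
    stable under scaling by [r]. *)
Lemma first_axis_ideal {R : comNzRingType} {S : set (R * R)} :
  subring S -> range (@diag R) `<=` S -> ideal_or_unit (first_axis S).
Proof.
move=> ringS SD; split; first by apply: SD; exists 0.
move=> r x y Sx Sy; rewrite /first_axis /=.
have -> : (r * x + y, 0) = diag r * (x, 0) + (y, 0).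
  by congr pair; rewrite /= ?mulr0 ?addr0.
apply: subring_add => //.
have /subringP[_ _ SM] := ringS.
by apply: SM => //; apply: SD; exists r.
Qed.

Lemma fiber_squareK {R : comNzRingType} (I : set R) :
  first_axis (fiber_square I) = I.
Proof.
by apply/seteqP; split=> x; rewrite /first_axis /fiber_square /= subr0.
Qed.

Lemma first_axisK {R : comNzRingType} {S : set (R * R)} :
  subring S -> range (@diag R) `<=` S -> fiber_square (first_axis S) = S.
Proof.
move=> ringS SD; have /subringP[_ SB _] := ringS.
have SDr r : S (diag r) by apply: SD; exists r.
apply/seteqP; split=> -[x y]; rewrite /fiber_square /first_axis /= => Sxy.
  have -> : (x, y) = (x - y, 0) + diag y.
    by congr pair; rewrite /= ?subrK ?add0r.
  exact: subring_add.
have -> : (x - y, 0) = (x, y) - diag y by congr pair; rewrite /= subrr.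
exact: SB.
Qed.

Lemma fiber_square_subset {R : comNzRingType} (I J : set R) :
  (fiber_square I `<=` fiber_square J) = (I `<=` J).
Proof.
apply/propext; split=> [IJ|IJ p]; last exact: IJ.
by rewrite -[I]fiber_squareK -[J]fiber_squareK => x; exact: IJ.
Qed.

Lemma fiber_square_proper {R : comNzRingType} (I J : set R) :
  (fiber_square I `<` fiber_square J) = (I `<` J).
Proof. by rewrite /proper !fiber_square_subset. Qed.

Lemma fiber_squareT {R : comNzRingType} :
  fiber_square [set: R] = [set: (R * R)%type].
Proof. by []. Qed.

(** The trace of any subring containing the diagonal and [(a, b)] is an ideal
    containing [a - b], and conversely [fiber_square (principal_ideal (a - b))]
    is such a subring; hence it is the smallest one. *)
Lemma adjoin_diagE {R : comNzRingType} (a b : R) :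
  adjoin (range (@diag R)) (a, b) = fiber_square (principal_ideal (a - b)).
Proof.
have idP := principal_ideal_or_unit (a - b).
apply/seteqP; split.
  apply: smallest_sub; first exact: fiber_square_subring.
  move=> q [Dq|->]; first exact: diag_fiber_square idP _ Dq.
  by exists 1; rewrite ?mul1r.
move=> p Pp S [ringS DabS].
have SD : range (@diag R) `<=` S by move=> q Dq; apply: DabS; left.
have Sab : S (a, b) by apply: DabS; right.
move: p Pp; rewrite -(first_axisK ringS SD) -/(subset _ _).
rewrite fiber_square_subset => _ [r _ <-].
have [S0 SZD] := first_axis_ideal ringS SD.
rewrite -[r * _]addr0; apply: SZD => //.
by move: Sab; rewrite -{1}(first_axisK ringS SD).
Qed.

Theorem theorem2p3 (R : comNzRingType) (a b : R) :
  minimal_ring_extension (adjoin (range (@diag R)) (a, b)) [set: (R * R)%type]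
  <-> maximal_ideal (principal_ideal (a - b)).
Proof.
rewrite adjoin_diagE; set M := principal_ideal _.
have idM : ideal_or_unit M := principal_ideal_or_unit _.
split=> [[_ _ MT noS]|[/idealr_closedP[_ M1] maxM]].
  move: MT; rewrite -fiber_squareT fiber_square_proper => -[_ nTM].
  split.
    apply/idealr_closedP; split=> // M1.
    by apply: nTM; rewrite (ideal_or_unit_eqT idM M1).
  move=> I /idealr_closedP[idI I1] MI.
  apply: contrapT => neqIM; apply: noS; exists (fiber_square I); split.
  - exact: fiber_square_subring.
  - rewrite fiber_square_proper; split=> // IM.
    by apply: neqIM; apply/seteqP.
  - rewrite -fiber_squareT fiber_square_proper; split=> // TI.
    by apply: I1; exact: TI.
split.
- exact: fiber_square_subring.
- by apply/subringP; split.
- rewrite -fiber_squareT fiber_square_proper; split=> // TM.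
  by apply: M1; exact: TM.
move=> [S [ringS ltMS ltST]].
have SD : range (@diag R) `<=` S.
  by apply: subset_trans (diag_fiber_square idM) _; case: ltMS.
have idS := first_axis_ideal ringS SD.
move: ltMS ltST; rewrite -(first_axisK ringS SD) -fiber_squareT.
rewrite !fiber_square_proper => -[MS nSM] [_ nTS].
apply: nSM; rewrite (maxM (first_axis S)) //.
apply/idealr_closedP; split=> // S1.
by apply: nTS; rewrite (ideal_or_unit_eqT idS S1).
Qed.
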